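(* Let $(M,L)$ be a spin$^c$ manifold. Let $(g,h,A)$ be a triple consisting of a Riemannian metric $g$ on $M$, a hermitian metric $h$ on $L$, and a connection $A$ on $L$. Then the condition $R^{\mathrm{tw}}_{(g,A)}>0$ is equivalent to the condition $R^{\mathrm{gen}}_{(g,A)}>0$.
   Context: A spin$^c$ manifold $(M,L)$ is a smooth oriented $n$-manifold $M$ equipped with a complex line bundle $L$ such that $c_1(L)$ reduces mod $2$ to $w_2(M)$, with the corresponding spin$^c$ structure with determinant line bundle $L$ and its complex spinor bundle. Connections on $L$ are unitary with respect to $h$. Let $\Omega$ be the (real) curvature $2$-form of $A$ (the curvature of $A$ up to a factor $\pm i$), let $c(\Omega)=\sum_{i<j}\Omega(e_i,e_j)\,e_i\cdot e_j$ (local orthonormal frame $e_i$) be Clifford multiplication by $\Omega$ acting on spinors, and let $|\Omega|_{op}(x)=\max\{|c(\Omega)\psi(x)| : |\psi(x)|=1\}$ be its pointwise operator norm. Let $R_g$ be the scalar curvature of $g$. The twisted scalar curvature is the section $R^{\mathrm{tw}}_{(g,A)}:=R_g+2i\,c(\Omega)$ of the endomorphism bundle of the spinor bundle; $R^{\mathrm{tw}}_{(g,A)}>0$ means that this self-adjoint endomorphism is positive-definite at every point of $M$. The generalized scalar curvature is the real function $R^{\mathrm{gen}}_{(g,A)}:=R_g-2|\Omega|_{op}$; $R^{\mathrm{gen}}_{(g,A)}>0$ means positive at every point of $M$. *)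

(* Defs.v *)
(* MathComp-Analysis, over an abstract realType R; complex numbers are R[i]. *)
From HB Require Import structures.
From mathcomp Require Import all_boot all_order all_algebra.
From mathcomp Require Import all_classical all_reals all_analysis.
From mathcomp Require Import complex.

Set Implicit Arguments.
Unset Strict Implicit.
Unset Printing Implicit Defensive.

Import Order.TTheory GRing.Theory Num.Theory.
Import numFieldNormedType.Exports.

Local Open Scope classical_set_scope.
Local Open Scope complex_scope.
Local Open Scope sesquilinear_scope.
Local Open Scope ring_scope.

(** * Smooth manifolds *)

Definition partial (R : realType) (n : nat) (k : 'I_n)
    (f : 'rV[R]_n -> R) (u : 'rV[R]_n) : R :=
  'D_(delta_mx 0 k) f u.

(* f is of class C^m on D; D is always an open set below. *)
Fixpoint class_C (R : realType) (n m : nat) (D : set 'rV[R]_n)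
    (f : 'rV[R]_n -> R) : Prop :=
  (forall u, D u -> {for u, continuous f}) /\
  match m with
  | 0 => True
  | m'.+1 => forall k : 'I_n,
      (forall u, D u -> derivable f u (delta_mx 0 k)) /\
      class_C m' D (partial k f)
  end.

Definition smooth_on (R : realType) (n : nat) (D : set 'rV[R]_n)
    (f : 'rV[R]_n -> R) : Prop :=
  forall m : nat, class_C m D f.

(* Entry (a, b) is d_a f^b, the transpose of the usual convention: for v = f u,
   d/du^a = sum_b (jacobian_mx f u a b) d/dv^b. *)
Definition jacobian_mx (R : realType) (n : nat)
    (f : 'rV[R]_n -> 'rV[R]_n) (u : 'rV[R]_n) : 'M[R]_n :=
  \matrix_(a, b) partial a (fun v => f v 0 b) u.

(* An oriented smooth n-manifold, given by an oriented atlas. The functions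
   chart i and chart_inv i are total, but meaningful only on dom i and on
   chart i @` dom i. *)
Record oriented_manifold (R : realType) (n : nat) := OrientedManifold {
  carrier :> topologicalType;
  manifold_hausdorff : hausdorff_space carrier;
  manifold_second_countable : @second_countable carrier;
  chart_index : Type;
  dom : chart_index -> set carrier;
  chart : chart_index -> carrier -> 'rV[R]_n;
  chart_inv : chart_index -> 'rV[R]_n -> carrier;
  chart_cover : forall x, exists i, dom i x;
  dom_open : forall i, open (dom i);
  chart_open : forall i, open (chart i @` dom i);
  chartK : forall i x, dom i x -> chart_inv i (chart i x) = x;
  chart_continuous : forall i x, dom i x -> {for x, continuous (chart i)};
  chart_inv_continuous : forall i x, dom i x ->
    {for chart i x, continuous (chart_inv i)};
  transition_smooth : forall i j (b : 'I_n),
    smooth_on (chart i @` (dom i `&` dom j))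
      (fun u => chart j (chart_inv i u) 0 b);
  transition_oriented : forall i j x, dom i x -> dom j x ->
    0 < \det (jacobian_mx (chart j \o chart_inv i) (chart i x))
}.
Arguments chart_index {R n} M : rename.
Arguments dom {R n M} i _ : rename.
Arguments chart {R n M} i _ : rename.
Arguments chart_inv {R n M} i _ : rename.

Section Manifold.
Context (R : realType) (n : nat) (M : oriented_manifold R n).

(* The matrix of the coordinate change at x from chart i to chart j. *)
Definition change (i j : chart_index M) (x : M) : 'M[R]_n :=
  jacobian_mx (chart j \o chart_inv i) (chart i x).

Definition smooth_fun (D : set M) (f : M -> R) : Prop :=
  forall i, smooth_on (chart i @` (dom i `&` D)) (f \o chart_inv i).

Definition smooth_cfun (D : set M) (f : M -> R[i]) : Prop :=
  smooth_fun D (fun x => complex.Re (f x)) /\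
  smooth_fun D (fun x => complex.Im (f x)).

Definition coord_deriv (i : chart_index M) (k : 'I_n) (f : M -> R) (x : M) : R :=
  partial k (f \o chart_inv i) (chart i x).

Definition coord_cderiv (i : chart_index M) (k : 'I_n) (f : M -> R[i])
    (x : M) : R[i] :=
  coord_deriv i k (fun y => complex.Re (f y)) x
  +i* coord_deriv i k (fun y => complex.Im (f y)) x.

Definition chart_at (x : M) : chart_index M := projT1 (cid (chart_cover x)).

(** * Riemannian metrics and scalar curvature *)

(* gmx i x is the matrix of g_x in the coordinates of chart i. *)
Record riemannian_metric := RiemannianMetric {
  gmx : chart_index M -> M -> 'M[R]_n;
  gmx_smooth : forall i a b, smooth_fun (dom i) (fun x => gmx i x a b);
  gmx_sym : forall i x, dom i x -> (gmx i x)^T = gmx i x;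
  gmx_posdef : forall i x, dom i x ->
    forall v : 'rV[R]_n, v != 0 -> 0 < (v *m gmx i x *m v^T) 0 0;
  gmx_change : forall i j x, dom i x -> dom j x ->
    gmx i x = change i j x *m gmx j x *m (change i j x)^T
}.

Variable g : riemannian_metric.

(* Gamma^k_{ab} *)
Definition christoffel (i : chart_index M) (k a b : 'I_n) (x : M) : R :=
  2^-1 * \sum_l invmx (gmx g i x) k l *
    (coord_deriv i a (fun y => gmx g i y b l) x +
     coord_deriv i b (fun y => gmx g i y a l) x -
     coord_deriv i l (fun y => gmx g i y a b) x).

(* R^l_{kab}, where R(d_a, d_b) d_k = R^l_{kab} d_l and
   R(X, Y) = [nabla_X, nabla_Y] - nabla_[X, Y]. *)
Definition riemann (i : chart_index M) (l k a b : 'I_n) (x : M) : R :=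
  coord_deriv i a (christoffel i l b k) x
  - coord_deriv i b (christoffel i l a k) x
  + \sum_p (christoffel i l a p x * christoffel i p b k x
            - christoffel i l b p x * christoffel i p a k x).

Definition ricci (i : chart_index M) (b k : 'I_n) (x : M) : R :=
  \sum_a riemann i a k a b x.

(* The value does not depend on the chart containing x. *)
Definition scalar_curvature (x : M) : R :=
  let i := chart_at x in
  \sum_a \sum_b invmx (gmx g i x) a b * ricci i a b x.

(** * Hermitian line bundles with unitary connection *)

(* A complex line bundle trivialised over an open cover by local frames e_a,
   with e_b = lb_trans a b * e_a on overlaps. *)
Record line_bundle := LineBundle {
  lb_index : Type;
  lb_dom : lb_index -> set M;
  lb_cover : forall x, exists a, lb_dom a x;
  lb_open : forall a, open (lb_dom a);
  lb_trans : lb_index -> lb_index -> M -> R[i];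
  lb_trans_smooth : forall a b,
    smooth_cfun (lb_dom a `&` lb_dom b) (lb_trans a b);
  lb_trans_neq0 : forall a b x, lb_dom a x -> lb_dom b x -> lb_trans a b x != 0;
  lb_cocycle : forall a b c x, lb_dom a x -> lb_dom b x -> lb_dom c x ->
    lb_trans a b x * lb_trans b c x = lb_trans a c x
}.

Variable L : line_bundle.

(* herm a x is the squared length h(e_a, e_a) at x. *)
Record hermitian_metric := HermitianMetric {
  herm : lb_index L -> M -> R;
  herm_smooth : forall a, smooth_fun (lb_dom a) (herm a);
  herm_gt0 : forall a x, lb_dom a x -> 0 < herm a x;
  herm_change : forall a b x, lb_dom a x -> lb_dom b x ->
    (herm b x)%:C = `|lb_trans a b x| ^+ 2 * (herm a x)%:C
}.

Variable h : hermitian_metric.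

(* conn a i x lists the components in chart i of the connection form theta_a,
   where nabla e_a = theta_a (x) e_a. *)
Record unitary_connection := UnitaryConnection {
  conn : lb_index L -> chart_index M -> M -> 'rV[R[i]]_n;
  conn_smooth : forall a i k,
    smooth_cfun (lb_dom a `&` dom i) (fun x => conn a i x 0 k);
  conn_chart_change : forall a i j x, lb_dom a x -> dom i x -> dom j x ->
    conn a i x = conn a j x *m (map_mx (real_complex R) (change i j x))^T;
  (* theta_b = theta_a + t^-1 dt, with t the transition function *)
  conn_frame_change : forall a b i x k, lb_dom a x -> lb_dom b x -> dom i x ->
    conn b i x 0 k = conn a i x 0 k +
      (lb_trans a b x)^-1 * coord_cderiv i k (lb_trans a b) x;
  (* d h(e_a, e_a) = h(nabla e_a, e_a) + h(e_a, nabla e_a) *)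
  conn_unitary : forall a i x k, lb_dom a x -> dom i x ->
    (coord_deriv i k (herm h a) x)%:C =
      (herm h a x)%:C * (conn a i x 0 k + (conn a i x 0 k)^*)
}.

Variable A : unitary_connection.

(* Components in chart i of the curvature d theta_a of A. It is imaginary-valued
   and independent of the frame e_a. *)
Definition curvature (a : lb_index L) (i : chart_index M) (x : M) : 'M[R[i]]_n :=
  \matrix_(k, l) (coord_cderiv i k (fun y => conn A a i y 0 l) x -
                  coord_cderiv i l (fun y => conn A a i y 0 k) x).

Definition frame_at (x : M) : lb_index L := projT1 (cid (lb_cover L x)).

(* The real 2-form Omega = -i F, where F is the curvature; as F is imaginary
   this is its imaginary part. *)
Definition Omega (i : chart_index M) (x : M) : 'M[R]_n :=
  map_mx (@complex.Im R) (curvature (frame_at x) i x).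

End Manifold.

(** * Spin^c structures *)

(* A complex representation of the Clifford algebra of R^n, with the convention
   v.v = -|v|^2, on the hermitian space C^N with N = 2^(floor(n/2)), in which
   unit vectors act unitarily. By its dimension it is irreducible, and its
   restriction to Spin(n) is the complex spin representation. *)
Record spin_rep (R : realType) (n : nat) := SpinRep {
  gam : 'I_n -> 'M[R[i]]_(2 ^ n./2);
  gam_clifford : forall j k,
    gam j *m gam k + gam k *m gam j = (- (2 * (j == k)%:R))%:M;
  gam_skew : forall j, (gam j)^t* = - gam j
}.

Section SpinC.
Context (R : realType) (n : nat) (rho : spin_rep R n).

Definition clifford_vec (v : 'rV[R]_n) : 'M[R[i]]_(2 ^ n./2) :=
  \sum_k (v 0 k)%:C *: gam rho k.

(* Spin(n) is realised by its faithful spin representation: products of an even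
   number of unit vectors. *)
Definition is_spin (s : 'M[R[i]]_(2 ^ n./2)) : Prop :=
  exists vs : seq 'rV[R]_n,
    [/\ ~~ odd (size vs), all (fun v => v *m v^T == 1%:M) vs
      & s = \big[mulmx/1%:M]_(v <- vs) clifford_vec v].

(* S is an element [s, z] of Spin^c(n) = Spin(n) x_{+-1} U(1) which maps to the
   rotation e_k |-> sum_l B k l e_l in SO(n) and to lam = z^2 in U(1). *)
Definition spinc_lift (S : 'M[R[i]]_(2 ^ n./2)) (B : 'M[R]_n) (lam : R[i]) : Prop :=
  exists (s : 'M[R[i]]_(2 ^ n./2)) (z : R[i]),
    [/\ is_spin s, `|z| = 1, S = z *: s,
        forall k, s *m gam rho k = clifford_vec (row k B) *m s
      & lam = z ^+ 2].

Context (M : oriented_manifold R n) (L : line_bundle M)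
  (g : riemannian_metric M) (h : hermitian_metric L).

(* A spin^c structure on (M, g) with determinant line bundle (L, h), i.e. a
   principal Spin^c(n)-bundle P with an equivariant bundle map from P to
   P_SO(M, g) x P_U(1)(L, h), given by local sections of P over an open cover.
   The image of the local section al is the oriented orthonormal frame
   (E_k)_k, whose components in chart i are the rows of so_frame al i x, and the
   unit section of L with coefficient u1_frame al a x in the frame e_a.
   The local sections are related by p_be = p_al * sc_trans al be. *)
Record spinc_structure := SpincStructure {
  sc_index : Type;
  sc_dom : sc_index -> set M;
  sc_cover : forall x, exists al, sc_dom al x;
  sc_open : forall al, open (sc_dom al);

  so_frame : sc_index -> chart_index M -> M -> 'M[R]_n;
  so_frame_smooth : forall al i k a,
    smooth_fun (sc_dom al `&` dom i) (fun x => so_frame al i x k a);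
  so_frame_change : forall al i j x, sc_dom al x -> dom i x -> dom j x ->
    so_frame al j x = so_frame al i x *m change i j x;
  so_frame_orthonormal : forall al i x, sc_dom al x -> dom i x ->
    so_frame al i x *m gmx g i x *m (so_frame al i x)^T = 1%:M;
  so_frame_oriented : forall al i x, sc_dom al x -> dom i x ->
    0 < \det (so_frame al i x);

  u1_frame : sc_index -> lb_index L -> M -> R[i];
  u1_frame_smooth : forall al a,
    smooth_cfun (sc_dom al `&` lb_dom a) (u1_frame al a);
  u1_frame_change : forall al a b x, sc_dom al x -> lb_dom a x -> lb_dom b x ->
    u1_frame al a x = lb_trans a b x * u1_frame al b x;
  u1_frame_unit : forall al a x, sc_dom al x -> lb_dom a x ->
    `|u1_frame al a x| ^+ 2 * (herm h a x)%:C = 1;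

  sc_trans : sc_index -> sc_index -> M -> 'M[R[i]]_(2 ^ n./2);
  sc_trans_smooth : forall al be p q,
    smooth_cfun (sc_dom al `&` sc_dom be) (fun x => sc_trans al be x p q);
  sc_cocycle : forall al be de x, sc_dom al x -> sc_dom be x -> sc_dom de x ->
    sc_trans al be x *m sc_trans be de x = sc_trans al de x;
  sc_trans_lift : forall al be x, sc_dom al x -> sc_dom be x ->
    exists (B : 'M[R]_n) (lam : R[i]),
      [/\ spinc_lift (sc_trans al be x) B lam,
          forall i, dom i x -> so_frame be i x = B *m so_frame al i x
        & forall a, lb_dom a x -> u1_frame be a x = lam * u1_frame al a x]
}.

Context (A : unitary_connection h) (P : spinc_structure).

(** * Twisted and generalized scalar curvature *)

(* The spinor bundle is associated to P by the action of Spin^c(n) on C^N, and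
   a local section al of P identifies its fibre at x with C^N, isometrically and
   so that E_k acts by gam k. We identify the fibre at x with C^N through
   sc_at x; another local section conjugates the endomorphisms below by the
   unitary matrix sc_trans. *)
Definition sc_at (x : M) : sc_index P := projT1 (cid (sc_cover P x)).

Definition spinor_norm (psi : 'cV[R[i]]_(2 ^ n./2)) : R :=
  Num.sqrt (complex.Re ((psi^t* *m psi) 0 0)).

(* The matrix Omega(E_j, E_k) in the orthonormal frame at x. *)
Definition Omega_frame (x : M) : 'M[R]_n :=
  let i := chart_at x in
  let E := so_frame (sc_at x) i x in
  E *m Omega A i x *m E^T.

Definition clifford_Omega (x : M) : 'M[R[i]]_(2 ^ n./2) :=
  \sum_(j < n) \sum_(k < n | (j < k)%N)
    (Omega_frame x j k)%:C *: (gam rho j *m gam rho k).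

(* The set is compact and nonempty, so this supremum is a maximum. *)
Definition Omega_op (x : M) : R :=
  sup [set spinor_norm (clifford_Omega x *m psi)
      | psi in [set psi | spinor_norm psi = 1]].

Definition twisted_scalar_curvature (x : M) : 'M[R[i]]_(2 ^ n./2) :=
  (scalar_curvature g x)%:C%:M + (2 * 'i) *: clifford_Omega x.

Definition generalized_scalar_curvature (x : M) : R :=
  scalar_curvature g x - 2 * Omega_op x.

Definition positive_definite (T : 'M[R[i]]_(2 ^ n./2)) : Prop :=
  T^t* = T /\
  forall psi : 'cV[R[i]]_(2 ^ n./2), psi != 0 -> 0 < (psi^t* *m T *m psi) 0 0.

End SpinC.

(* Main.v *)
(* The matrix H = i c(Omega) is hermitian, and the positivity of R + 2 H says
   that R + 2 l > 0 for every eigenvalue l of H, whereas that of R - 2 |Omega|_op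
   says that R > 2 |l| for every l. These agree because the spectrum of H is
   symmetric about 0: the trace of a product of evenly many gamma matrices is
   real, so tr(c(Omega)^m) is real for every m; for odd m, tr(H^m) is then both
   real and imaginary, hence zero, and a finite family of reals all of whose odd
   power sums vanish is symmetric. *)
Require Import Defs.
From mathcomp Require Import all_boot all_order all_algebra.
From mathcomp Require Import all_classical all_reals all_analysis.
From mathcomp Require Import complex.

Set Implicit Arguments.
Unset Strict Implicit.
Unset Printing Implicit Defensive.

Import Order.TTheory GRing.Theory Num.Theory.

Local Open Scope complex_scope.
Local Open Scope sesquilinear_scope.
Local Open Scope ring_scope.

(** * Traces of words in Clifford generators, and Clifford action of real 2-forms *)

Section CliffordWords.
Context (C : numClosedFieldType) (n N : nat) (gam : 'I_n -> 'M[C]_N).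
Hypothesis gam_clifford : forall j k,
  gam j *m gam k + gam k *m gam j = (- (2 * (j == k)%:R))%:M.

Definition clifford_word (w : seq 'I_n) : 'M[C]_N :=
  foldr (fun j => mulmx (gam j)) 1%:M w.

Lemma clifford_word_cat u v :
  clifford_word (u ++ v) = clifford_word u *m clifford_word v.
Proof. by elim: u => [|j u IH] /=; rewrite ?mul1mx// IH mulmxA. Qed.

Lemma clifford_sqr j : gam j *m gam j = - 1%:M.
Proof.
have := gam_clifford j j; rewrite eqxx mulr1 -mulr2n -scaler_nat.
move=> /(congr1 ( *:%R 2^-1)); rewrite scalerA mulVf ?pnatr_eq0// scale1r => ->.
by rewrite scale_scalar_mx mulrN mulVf ?pnatr_eq0// raddfN.
Qed.

Lemma clifford_anticomm j k : j != k -> gam k *m gam j = - (gam j *m gam k).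
Proof.
move=> /negPf jk; have := gam_clifford j k.
by rewrite jk mulr0 oppr0 raddf0 addrC => /eqP; rewrite addr_eq0 => /eqP.
Qed.

(** Each letter of [w] differs from [j], so [gam j] passes it at the cost of one sign. *)
Lemma clifford_word_comm j w : j \notin w ->
  clifford_word w *m gam j = (-1) ^+ size w *: (gam j *m clifford_word w).
Proof.
elim: w => [|k w IH]; first by rewrite mul1mx mulmx1 scale1r.
rewrite inE negb_or => /andP[jk jw].
rewrite /= -mulmxA IH// -scalemxAr (mulmxA (gam k)) (mulmxA (gam j))
  clifford_anticomm//.
by rewrite mulNmx scalerN exprS mulN1r scaleNr.
Qed.

(* If j occurs once in the word j :: w, cyclicity of the trace and
   anticommutation give tr = - tr; otherwise the first two occurrences of j are
   brought together and cancelled. *)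
Lemma even_clifford_word_trace_real w : ~~ odd (size w) ->
  \tr (clifford_word w) \is Num.real.
Proof.
have [m] := ubnP (size w); elim: m w => // m IH [|j w].
  by rewrite mxtrace1 realn.
rewrite ltnS /= negbK => wm ow.
have [jw|jw] := boolP (j \in w).
  have ju : j \notin take (index j w) w by rewrite in_take// ltnn.
  have Ew := cat_take_drop (index j w) w; rewrite drop_index// in Ew.
  move: (take _ _) (drop _.+1 w) ju Ew => u v ju Ew.
  move: wm ow; rewrite -{w jw}Ew size_cat /= addnS => wm ow.
  rewrite /= clifford_word_cat /= (mulmxA (clifford_word u)) clifford_word_comm//.
  rewrite -scalemxAl -scalemxAr mxtraceZ rpredMsign !mulmxA clifford_sqr.
  rewrite !mulNmx mul1mx raddfN rpredN -clifford_word_cat.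
  by apply: IH; rewrite size_cat ?(ltnW wm)// -[odd _]negbK.
have : \tr (clifford_word (j :: w)) = - \tr (clifford_word (j :: w)).
  rewrite /= {1}mxtrace_mulC clifford_word_comm//.
  by rewrite -signr_odd ow scaleN1r raddfN.
by move=> /eqP; rewrite -addr_eq0 -mulr2n mulrn_eq0 => /eqP ->; rewrite real0.
Qed.

Variable a : 'I_n -> 'I_n -> C.
Hypothesis a_real : forall j k, a j k \is Num.real.

(** Shaped like [clifford_Omega], so that the results below apply to it by conversion. *)
Let c := \sum_(j < n) \sum_(k < n | (j < k)%N) a j k *: (gam j *m gam k).

Lemma clifford_2form_trace_real m : \tr (c ^+ m) \is Num.real.
Proof.
(* The extra word makes the induction on [m] work: expanding one factor [c] puts two letters in
   front of [w], keeping its length even, with real coefficients. *)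
suff cw w : ~~ odd (size w) -> \tr (c ^+ m *m clifford_word w) \is Num.real.
  by rewrite -[c ^+ m]mulmx1; apply: (cw [::]).
elim: m w => [|m IH] w ow; first by rewrite mul1mx even_clifford_word_trace_real.
rewrite exprSr -[c ^+ m * c]/(c ^+ m *m c) -mulmxA mulmx_suml mulmx_sumr.
rewrite raddf_sum rpred_sum// => j _; rewrite mulmx_suml mulmx_sumr.
rewrite raddf_sum rpred_sum// => k _; rewrite -scalemxAl -scalemxAr /= mxtraceZ /=.
by rewrite rpredM// -mulmxA; apply: (IH [:: j, k & w]); rewrite /= negbK.
Qed.

Hypothesis gam_skew : forall j, (gam j)^t* = - gam j.

(** The adjoint of [gam j *m gam k] is [gam k *m gam j], as the two signs cancel; for [j < k]
    anticommutation turns this into [- (gam j *m gam k)]. *)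
Lemma clifford_2form_skew : c^t* = - c.
Proof.
have trC_sum (I : finType) (Q : pred I) (F : I -> 'M[C]_N) :
    (\sum_(i | Q i) F i)^t* = \sum_(i | Q i) (F i)^t*.
  by rewrite raddf_sum map_mx_sum.
rewrite trC_sum -sumrN; apply: eq_bigr => j _.
rewrite trC_sum -sumrN; apply: eq_bigr => k jk.
rewrite linearZ /= map_mxZ trmx_mul map_mxM !gam_skew mulNmx mulmxN opprK.
rewrite /= (CrealP (a_real j k)) clifford_anticomm ?scalerN ?opprK//.
by apply: contraTneq jk => ->; rewrite ltnn.
Qed.

End CliffordWords.

(** * Power sums of eigenvalues and symmetry of the spectrum *)

Lemma expmxZ (C : comNzRingType) N (a : C) (A : 'M[C]_N) k :
  (a *: A) ^+ k = a ^+ k *: A ^+ k.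
Proof.
elim: k => [|k IH]; first by rewrite !expr0 scale1r.
rewrite exprS IH -[LHS]/(mulmx _ _) -scalemxAl -scalemxAr scalerA -exprS.
by rewrite [A ^+ k.+1]exprS.
Qed.

Lemma mxtrace_expmx (C : numClosedFieldType) N (A : 'M[C]_N) k :
  A \is normalmx -> \tr (A ^+ k) = \sum_i spectral_diag A 0 i ^+ k.
Proof.
move=> /orthomx_spectralP; set P := spectralmx A; set d := spectral_diag A => EA.
have uP : P \in unitmx := spectral_unit A.
suff -> : A ^+ k = invmx P *m diag_mx (\row_i d 0 i ^+ k) *m P.
  rewrite mxtrace_mulC mulmxA mulmxV// mul1mx mxtrace_diag.
  by apply: eq_bigr => i _; rewrite mxE.
elim: k => [|k IH].
  rewrite expr0 (_ : diag_mx _ = 1%:M) ?mulmx1 ?mulVmx//.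
  by apply/matrixP => i j; rewrite !mxE expr0.
rewrite exprS IH {1}EA -[LHS]/(mulmx _ _) !mulmxA mulmxK//.
rewrite -(mulmxA _ (diag_mx d)) mulmx_diag; congr (_ *m diag_mx _ *m _).
by apply/rowP => i; rewrite !mxE exprS.
Qed.

Lemma odd_power_sums0_symmetric (F : numFieldType) (I : finType) (l : I -> F) :
  (forall m, \sum_i l i ^+ m.*2.+1 = 0) -> forall i, exists j, l j = - l i.
Proof.
move=> l0 i.
(* X q(X^2) is an odd polynomial vanishing at every l j other than +- l i. *)
pose q := \prod_(j | l j ^+ 2 != l i ^+ 2) ('X - (l j ^+ 2)%:P).
(* Expanding [q] in coefficients gives a combination of odd power sums. *)
have sum0 : \sum_j l j * q.[l j ^+ 2] = 0.
  under eq_bigr do rewrite horner_coef mulr_sumr.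
  rewrite exchange_big big1// => m _ /=.
  transitivity (q`_m * \sum_j l j ^+ m.*2.+1); last by rewrite l0 mulr0.
  rewrite mulr_sumr; apply: eq_bigr => j _.
  by rewrite mulrCA -exprM mul2n exprS.
have q_neq0 : q.[l i ^+ 2] != 0.
  rewrite horner_prod; apply/prodf_neq0 => j.
  by rewrite hornerXsubC subr_eq0 eq_sym.
have [/existsP[j /eqP]|] := boolP [exists j, l j == - l i]; first by exists j.
move=> /existsPn nex.
have : \sum_(j | l j == l i) l i = 0.
  apply: (mulIf q_neq0); rewrite mul0r -{}[RHS]sum0 mulr_suml.
  rewrite [RHS](bigID (fun j => l j == l i)) /= [X in _ = _ + X]big1 ?addr0.
    by apply: eq_bigr => j /eqP->.
  move=> j ji; have lj : l j ^+ 2 != l i ^+ 2.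
    by rewrite eqf_sqr negb_or ji nex.
  by rewrite horner_prod (bigD1 j)//= hornerXsubC subrr mul0r mulr0.
(* The sum is [l i] times the number of [j] with [l j = l i]. That number is nonzero, since [i] is
   counted, so [l i = 0] and [i] is its own partner. *)
rewrite sumr_const => /eqP; rewrite mulrn_eq0 => /orP[|/eqP li0].
  by move=> /eqP /card0_eq /(_ i); rewrite !inE => /negP[]; apply: eqxx.
by exists i; rewrite li0 oppr0.
Qed.

Lemma imaginary_skew_hermitian (C : numClosedFieldType) N (c : 'M[C]_N) :
  c^t* = - c -> 'i *: c \is hermsymmx.
Proof.
move=> cN; apply/is_hermitianmxP; rewrite expr0 scale1r linearZ /= map_mxZ cN.
by rewrite /= conjCi scalerN scaleNr opprK.
Qed.

Lemma symmetric_spectrum (C : numClosedFieldType) N (c : 'M[C]_N) :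
  c^t* = - c -> (forall m, \tr (c ^+ m) \is Num.real) ->
  forall i, exists j, spectral_diag ('i *: c) 0 j = - spectral_diag ('i *: c) 0 i.
Proof.
move=> cN trc; have Hh := imaginary_skew_hermitian cN.
apply: odd_power_sums0_symmetric => m.
rewrite -mxtrace_expmx ?hermitian_normalmx// expmxZ mxtraceZ.
(* An odd power of ['i] times a real trace: [z] is imaginary. *)
set z := _ * _; have : z^* = - z.
  rewrite rmorphM rmorphXn /= conjCi (CrealP (trc _)) exprNn -signr_odd /=.
  by rewrite odd_double expr1 !mulNr mul1r.
(* Read back as the trace of a power of a hermitian matrix, [z] is a power sum of real
   eigenvalues. *)
have /CrealP -> : z \is Num.real.
  rewrite /z -mxtraceZ -expmxZ mxtrace_expmx ?hermitian_normalmx//.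
  rewrite rpred_sum// => i _.
  by rewrite rpredX// (mxOverP (hermitian_spectral_diag_real Hh)).
by move=> /eqP; rewrite -addr_eq0 -mulr2n mulrn_eq0 => /eqP.
Qed.

(** * Hermitian forms in an orthonormal eigenbasis *)

Section SpectralForms.
Context (C : numClosedFieldType) (N : nat) (H : 'M[C]_N).
Hypothesis H_normal : H \is normalmx.
Let P := spectralmx H.
Let d := spectral_diag H.

Lemma form1_spectral (psi : 'cV[C]_N) :
  (psi^t* *m psi) 0 0 = \sum_i `|(P *m psi) i 0| ^+ 2.
Proof.
have -> : psi^t* *m psi = (P *m psi)^t* *m (P *m psi).
  by rewrite trmx_mul map_mxM mulmxA mulmxKtV ?spectral_unitarymx// trmxC_unitary.
by rewrite mxE; apply: eq_bigr => i _; rewrite !mxE mulrC normCK.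
Qed.

Lemma spectral_mulmx (psi : 'cV[C]_N) i :
  (P *m (H *m psi)) i 0 = d 0 i * (P *m psi) i 0.
Proof.
have /orthomx_spectralP EH := H_normal.
by rewrite {1}EH !mulmxA mulmxV ?spectral_unit// mul1mx -mulmxA mul_diag_mx mxE.
Qed.

Lemma form_spectral (psi : 'cV[C]_N) :
  (psi^t* *m H *m psi) 0 0 = \sum_i d 0 i * `|(P *m psi) i 0| ^+ 2.
Proof.
have -> : psi^t* *m H *m psi = (P *m psi)^t* *m (P *m (H *m psi)).
  by rewrite trmx_mul map_mxM !mulmxA mulmxKtV ?spectral_unitarymx// trmxC_unitary.
rewrite mxE; apply: eq_bigr => i _.
by rewrite spectral_mulmx !mxE mulrCA normCK (mulrC (_^*)).
Qed.
End SpectralForms.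

(** * Positivity and operator norm in terms of eigenvalues *)

Section PointwisePositivity.
Context (R : realType) (n : nat) (H : 'M[R[i]]_(2 ^ n./2)).
Hypothesis H_herm : H \is hermsymmx.

Let N := (2 ^ n./2)%N.
Let P := spectralmx H.
(** The eigenvalues of the hermitian [H] are real; taking real parts moves them to [R], where the
    supremum lives. *)
Let l (i : 'I_N) : R := complex.Re (spectral_diag H 0 i).

Let H_normal : H \is normalmx := hermitian_normalmx H_herm.

Let lE i : spectral_diag H 0 i = (l i)%:C.
Proof.
by rewrite /l RRe_real// (mxOverP (hermitian_spectral_diag_real H_herm)).
Qed.

Let sqr_comp (psi : 'cV[R[i]]_N) (i : 'I_N) : R :=
  complex.Re (`|(P *m psi) i 0| ^+ 2).

Let sqr_compE psi i : `|(P *m psi) i 0| ^+ 2 = (sqr_comp psi i)%:C.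
Proof. by rewrite /sqr_comp RRe_real// rpredX// normr_real. Qed.

Let sqr_comp_ge0 psi i : 0 <= sqr_comp psi i.
Proof. by rewrite -ler0c -sqr_compE exprn_ge0. Qed.

Let ltr0c (k : R) : (0 < k%:C) = (0 < k).
Proof. exact: (ltcR 0). Qed.

(** As [P] is unitary, [P^t*] inverts it, so this unit vector has [delta_mx i 0] as coordinates in
    the eigenbasis. *)
Let eigenvector i : 'cV[R[i]]_N := P^t* *m delta_mx i 0.

Let sqr_comp_eigenvector i j : sqr_comp (eigenvector i) j = (j == i)%:R.
Proof.
rewrite /sqr_comp /eigenvector mulmxA (unitarymxP (spectral_unitarymx H)) mul1mx.
by rewrite mxE andbT normr_nat -natrX; case: (j == i).
Qed.

Lemma spinor_norm_spectral (psi : 'cV[R[i]]_N) :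
  spinor_norm psi = Num.sqrt (\sum_i sqr_comp psi i).
Proof.
rewrite /spinor_norm (form1_spectral H); under eq_bigr do rewrite sqr_compE.
by rewrite -rmorph_sum.
Qed.

Lemma spinor_norm_mulmx_spectral (psi : 'cV[R[i]]_N) :
  spinor_norm (H *m psi) = Num.sqrt (\sum_i l i ^+ 2 * sqr_comp psi i).
Proof.
rewrite spinor_norm_spectral; congr Num.sqrt; apply: eq_bigr => i _.
apply: complexI; rewrite -sqr_compE spectral_mulmx// lE normrM exprMn sqr_compE.
by rewrite rmorphM rmorphXn /= -normrX ger0_norm// -rmorphXn ler0c sqr_ge0.
Qed.

(** In the eigenbasis the form is diagonal with coefficients [s + 2 * l i]. Eigenvectors test each
    coefficient; conversely a nonzero [psi] has a nonzero coordinate because [P] is invertible. *)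
Lemma positive_definite_spectral (s : R) :
  positive_definite (s%:C%:M + 2 *: H) <-> forall i, 0 < s + 2 * l i.
Proof.
have formE (psi : 'cV[R[i]]_N) : (psi^t* *m (s%:C%:M + 2 *: H) *m psi) 0 0 =
    (\sum_i (s + 2 * l i) * sqr_comp psi i)%:C.
  rewrite mulmxDr mulmxDl mul_mx_scalar -scalemxAl -scalemxAr -scalemxAl mxE.
  rewrite [X in X + _]mxE [X in _ + X]mxE (form1_spectral H) form_spectral//.
  rewrite !mulr_sumr -big_split rmorph_sum; apply: eq_bigr => i _ /=.
  have coefE : (s + 2 * l i)%:C = s%:C + 2 * (l i)%:C.
    by rewrite rmorphD rmorphM rmorph_nat.
  by rewrite [RHS]rmorphM /= coefE -lE -sqr_compE [RHS]mulrDl -[in RHS]mulrA.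
split=> [[_ Hpos] i|lpos].
  have := Hpos (eigenvector i); rewrite formE (bigD1 i)//= big1 ?addr0.
    rewrite sqr_comp_eigenvector eqxx mulr1 ltr0c; apply.
    apply/eqP => e0; have := sqr_comp_eigenvector i i.
    rewrite e0 /sqr_comp mulmx0 mxE normr0 expr0n eqxx => /eqP.
    by rewrite eq_sym oner_eq0.
  by move=> j ji; rewrite sqr_comp_eigenvector (negPf ji) mulr0.
split.
  have /is_hermitianmxP := H_herm; rewrite expr0 scale1r => HE.
  rewrite linearD /= map_mxD linearZ /= map_mxZ -HE tr_scalar_mx map_scalar_mx.
  by rewrite /= conj_Creal ?complex_real// conj_Creal// realn.
move=> psi psi_neq0; rewrite formE ltr0c lt_def sumr_ge0 ?andbT; last first.
  by move=> i _; rewrite mulr_ge0// ltW.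
rewrite psumr_neq0; last by move=> i _; rewrite mulr_ge0// ltW.
have /matrix0Pn[i [j]] : P *m psi != 0.
  by rewrite -(inj_eq (can_inj (mulKmx (spectral_unit H)))) mulmx0 in psi_neq0 *.
rewrite ord1 => psii; apply/hasP; exists i; first by rewrite mem_index_enum.
by rewrite mulr_gt0// -ltr0c -sqr_compE exprn_gt0// normr_gt0.
Qed.

(** The supremum is the largest [|l i|], attained at a corresponding eigenvector. *)
Lemma operator_norm_spectral (s : R) :
  (0 < s - 2 * sup [set spinor_norm (H *m psi)
                   | psi in [set psi | spinor_norm psi = 1]]%classic) <->
  forall i, 2 * `|l i| < s.
Proof.
set E := (X in sup X).
(* The spinor space has positive dimension, so a maximal [|l i|] exists. *)
have i0 : 'I_N by exists 0%N; rewrite expn_gt0.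
pose im := [arg max_(i > i0) `|l i|]%O.
have lm i : `|l i| <= `|l im|.
  by rewrite /im; case: arg_maxP => // j _; apply.
have ubE : ubound E `|l im|.
  move=> _ [psi psi1 <-]; rewrite spinor_norm_mulmx_spectral.
  move: psi1; rewrite /= spinor_norm_spectral => psi1.
  (* Multiplying the bound by the norm [1] of [psi] puts both sides under a square root, where the
     sums compare termwise. *)
  rewrite -[leRHS]mulr1 -psi1 -sqrtr_sqr -sqrtrM ?sqr_ge0// ler_wsqrtr//.
  rewrite mulr_sumr ler_sum// => i _; rewrite ler_wpM2r//.
  by rewrite -ler_sqrt ?sqr_ge0// !sqrtr_sqr.
have El i : E `|l i|.
  exists (eigenvector i) => /=.
    rewrite spinor_norm_spectral (bigD1 i)//= big1 ?addr0 => [|j ji].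
      by rewrite sqr_comp_eigenvector eqxx sqrtr1.
    by rewrite sqr_comp_eigenvector (negPf ji).
  rewrite spinor_norm_mulmx_spectral (bigD1 i)//= big1 ?addr0 => [|j ji].
    by rewrite sqr_comp_eigenvector eqxx mulr1 sqrtr_sqr.
  by rewrite sqr_comp_eigenvector (negPf ji) mulr0.
have -> : sup E = `|l im|.
  apply/le_anti/andP; split; first by apply: ge_sup => //; exists `|l im|.
  by apply: ub_le_sup => //; exists `|l im|.
rewrite subr_gt0; split=> // sl i; apply: le_lt_trans sl.
by rewrite ler_pM2l.
Qed.

End PointwisePositivity.

Theorem lemma3p1 (R : realType) (n : nat) (rho : spin_rep R n)
    (M : oriented_manifold R n) (L : line_bundle M)
    (g : riemannian_metric M) (h : hermitian_metric L)
    (A : unitary_connection h) (P : spinc_structure rho g h) :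
  (forall x : M, positive_definite (twisted_scalar_curvature A P x)) <->
  (forall x : M, 0 < generalized_scalar_curvature A P x).
Proof.
(* The equivalence already holds at each point. *)
suff eqv x : positive_definite (twisted_scalar_curvature A P x) <->
    0 < generalized_scalar_curvature A P x.
  by split=> + x => /(_ x); rewrite eqv.
pose c := clifford_Omega A P x; pose H := 'i *: c.
pose a j k : R[i] := (Omega_frame A P x j k)%:C.
have a_real j k : a j k \is Num.real by rewrite complex_real.
have cN : c^t* = - c.
  exact (clifford_2form_skew (gam_clifford rho) a_real (gam_skew rho)).
have Hh : H \is hermsymmx := imaginary_skew_hermitian cN.
have Hsym : forall i, exists j, spectral_diag H 0 j = - spectral_diag H 0 i.
  apply: symmetric_spectrum cN _ => m.
  exact (clifford_2form_trace_real (gam_clifford rho) a_real m).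
(* The scalar ['i] has modulus one, so [c] and [H] have the same operator norm. *)
have normH psi : spinor_norm (c *m psi) = spinor_norm (H *m psi).
  rewrite /spinor_norm -scalemxAl [(_ *: _)^T]linearZ /= map_mxZ /= -scalemxAl -scalemxAr.
  by rewrite scalerA conjCi mulNr -expr2 sqrCi opprK scale1r.
rewrite /twisted_scalar_curvature /generalized_scalar_curvature /Omega_op.
rewrite -scalerA -/c -/H; under eq_imagel do rewrite normH.
rewrite positive_definite_spectral// operator_norm_spectral//.
have ReN (z : R[i]) : complex.Re (- z) = - complex.Re z by case: z.
split=> ls i; last first.
  (* This direction only uses that [- l i] is at most [|l i|]. *)
  rewrite -ltrBlDr sub0r; apply: le_lt_trans (ls i); rewrite -mulrN ler_pM2l//.
  by rewrite -normrN ler_norm.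
(* Positivity at the opposite eigenvalue gives [2 * l i < s]; positivity at [l i] itself gives the
   lower bound [- s < 2 * l i]. *)
have [j lj] := Hsym i; have := ls j; rewrite lj ReN mulrN subr_gt0 => lt_s.
by rewrite -[2]ger0_norm// -normrM ltr_norml lt_s andbT -subr_gt0 opprK addrC.
Qed.
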